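(* Let $C\subseteq\{0,1\}^n$ be a binary linear code with a generating matrix $G$ (a matrix over $\mathbb F_2$ whose rows span $C$) in which every column appears with the same multiplicity. Let $\sigma\ge 1$ be an integer such that for every coordinate $i\in[n]$, $C^\perp$ contains at least $\sigma$ vectors of Hamming weight $3$ whose supports contain $i$. Then \[ \dim(C) \le \frac{2}{\sqrt{\sigma}}\, n. \]
   Context: $C^\perp$ is the dual code of $C$ over $\mathbb F_2$. A code with a generating matrix in which all columns have equal multiplicity is called regular; the condition on weight-$3$ dual vectors says the code is locally testable with $3$-density $\sigma$. *)

(* Defs.v *)
From mathcomp Require Import all_boot all_order all_algebra.

Set Implicit Arguments.
Unset Strict Implicit.
Unset Printing Implicit Defensive.

Import GRing.Theory.

Local Open Scope ring_scope.

Definition supp (n : nat) (v : 'rV['F_2]_n) : {set 'I_n} :=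
  [set i | v 0 i != 0].

Definition hweight (n : nat) (v : 'rV['F_2]_n) : nat := #|supp v|.

Definition dual_code (n : nat) (C : {vspace 'rV['F_2]_n}) :
    {set 'rV['F_2]_n} :=
  [set v : 'rV['F_2]_n |
    [forall u : 'rV['F_2]_n in C,
       \sum_(i < n) v 0 i * u 0 i == 0]].

(* The rows need not be linearly independent, so G may have more than
   \dim C rows. *)
Definition generating_matrix (m n : nat) (C : {vspace 'rV['F_2]_n})
    (G : 'M['F_2]_(m, n)) : Prop :=
  <<[seq row i G | i : 'I_m]>>%VS = C.

Definition col_mult (m n : nat) (G : 'M['F_2]_(m, n)) (j : 'I_n) : nat :=
  #|[set k : 'I_n | col k G == col j G]|.

Definition equal_col_mult (m n : nat) (G : 'M['F_2]_(m, n)) : Prop :=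
  forall j k : 'I_n, col_mult G j = col_mult G k.

(* The weight-3 dual vectors are counted as vectors, so two of them may share
   coordinates other than i. *)
Definition locally_testable3 (n : nat) (C : {vspace 'rV['F_2]_n})
    (sigma : nat) : Prop :=
  forall i : 'I_n,
    (sigma <= #|[set v in dual_code C | hweight v == 3 & i \in supp v]|)%N.

(* Main.v *)
(** Let psi_i be the columns of G, each of multiplicity t, and contract them
    repeatedly: replace a linear map f by its composite with a projection
    killing some f(psi_a).  This lowers the dimension of the span of the
    f(psi_i) by at most one.  Let q be the number of distinct values f(psi_i).
    A weight-3 dual vector with support {a,b,c} gives
    psi_a + psi_b + psi_c = 0, so contracting f(psi_a) merges f(psi_b) with
    f(psi_c), unless f(psi_a) = 0.  Averaging over a, some contraction lowers
    q by at least s q / N - 1/2, where N = n / t and s = sigma / t^2.  Contract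
    until q <= N / sqrt s and then bound the dimension by q: since every step
    loses at least sqrt s - 1/2 values, the total is at most 2 N / sqrt s.
    (If sqrt s < 2, the bound dim C <= N already suffices.) *)

Require Import Defs.
From mathcomp Require Import all_boot all_order all_algebra.
From mathcomp Require Import zify ring lra.

Set Implicit Arguments.
Unset Strict Implicit.
Unset Printing Implicit Defensive.

Import Order.TTheory GRing.Theory Num.Theory.

Local Open Scope ring_scope.

(** * Double counting and averaging *)

Lemma leq_sum_fiber (I J : finType) (P : {set I}) (S : {set J}) (h : I -> J)
    (w : I -> nat) (k : nat) :
  (forall y, y \in S -> k <= \sum_(x in P | h x == y) w x)%N ->
  (k * #|S| <= \sum_(x in P) w x)%N.
Proof.
move=> hk; rewrite mulnC -sum_nat_const.
apply: (@leq_trans (\sum_(y in S) \sum_(x in P | h x == y) w x)%N).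
  exact: leq_sum.
rewrite (exchange_big_dep (mem P)) /=; last by move=> ? ? _ /andP[].
apply: leq_sum => x Px.
rewrite (eq_bigl (fun y => (y \in S) && (y == h x))); last first.
  by move=> y; rewrite Px eq_sym.
rewrite big_mkcondl /= (big_pred1 (h x)) //=; by case: ifP.
Qed.

Lemma card_dep_pairs (I J : finType) (A : {set I}) (B : I -> {set J}) (t : nat) :
  (forall a, a \in A -> #|B a| <= t)%N ->
  (#|[set p : I * J | (p.1 \in A) && (p.2 \in B p.1)]| <= t * #|A|)%N.
Proof.
move=> hB; rewrite cardsE -sum1_card.
rewrite -(pair_big_dep (mem A) (fun a c => c \in B a) (fun _ _ => 1%N)) /=.
rewrite mulnC -sum_nat_const; apply: leq_sum => a aA.
by rewrite sum1_card hB.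
Qed.

Lemma exists_average (I : finType) (w : I -> nat) (i0 : I) :
  exists a, (\sum_i w i <= #|I| * w a)%N.
Proof.
exists [arg max_(i > i0) w i]; case: arg_maxnP => // a _ ha.
by rewrite -sum_nat_const; apply: leq_sum => i _; exact: ha.
Qed.

(** * Signs over F_2, and dimensions of spans *)

Lemma addvv_F2 (p q : nat) (v : 'M['F_2]_(p, q)) : v + v = 0.
Proof.
rewrite -mulr2n -scaler_nat (_ : 2%:R = 0) ?scale0r //; exact/val_inj.
Qed.

Lemma add_eq0_F2 (p q : nat) (u v : 'M['F_2]_(p, q)) : (u + v == 0) = (u == v).
Proof.
have vN : - v = v by apply/eqP; rewrite -subr_eq0 -opprD addvv_F2 oppr0.
by rewrite -{1}vN subr_eq0.
Qed.

(* The dual of a basis of the column space factors G through dimension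
   [\dim <<columns>>]. *)
Lemma dim_rows_le_cols (F : fieldType) (m n : nat) (G : 'M[F]_(m, n)) :
  (\dim <<[seq row i G | i : 'I_m]>> <= \dim <<[seq col j G | j : 'I_n]>>)%N.
Proof.
set U := <<[seq col j G | j : 'I_n]>>%VS.
pose D k : 'rV[F]_n := \row_j coord (vbasis U) k (col j G).
have colU j : col j G \in U by apply/memv_span/image_f.
have rowE i : row i G = \sum_(k < \dim U) (vbasis U)`_k i 0 *: D k.
  apply/rowP=> j; rewrite summxE !mxE.
  have /(congr1 (fun u : 'cV_m => u i 0)) := coord_vbasis (colU j).
  rewrite !mxE summxE => ->; apply: eq_bigr => k _.
  by rewrite !mxE mulrC.
have sub : (<<[seq row i G | i : 'I_m]>> <= <<[seq D k | k : 'I_(\dim U)]>>)%VS.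
  apply/span_subvP => u /mapP[i _ ->]; rewrite rowE; apply: memv_suml => k _.
  by apply/memvZ/memv_span/image_f.
apply: leq_trans (dimvS sub) _; apply: leq_trans (dim_span _) _.
by rewrite size_image card_ord.
Qed.

Lemma dim_span_image (K : finFieldType) (p q : nat) (I : finType)
    (phi : I -> 'M[K]_(p, q)) :
  (\dim <<[seq phi i | i : I]>> <= #|[set phi i | i : I]|)%N.
Proof.
have -> : <<[seq phi i | i : I]>>%VS = <<enum [set phi i | i : I]>>%VS.
  apply: eq_span => u; rewrite mem_enum; apply/imageP/imsetP => [] [i _ ->]; by exists i.
by apply: leq_trans (dim_span _) _; rewrite -cardE.
Qed.

(** * Contracting a finite family of vectors over F_2 *)

Section Contraction.

Variables (I : finType) (m : nat) (psi : I -> 'cV['F_2]_m) (sigma t : nat).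

(** The pairs are ordered, so a weight-3 dual vector through [b] yields two of them; hence the
    factor 2 in [pairs_ge]. *)
Definition zero_pairs (b : I) : {set I * I} :=
  [set p : I * I | [&& p.1 != b, p.2 != b, p.1 != p.2
                     & psi b + psi p.1 + psi p.2 == 0]].

Hypothesis fiber_le : forall w, (#|[set k | psi k == w]| <= t)%N.
Hypothesis pairs_ge : forall b, (2 * sigma <= #|zero_pairs b|)%N.

Implicit Type f : 'End('cV['F_2]_m).

Definition values f : {set 'cV['F_2]_m} := [set f (psi i) | i : I].

Definition span_dim f : nat := \dim <<[seq f (psi i) | i : I]>>.

(** Subtracting the projection realises the quotient by a line inside the same space, so
    contractions can be iterated. *)
Definition contract f (a : I) : 'End('cV['F_2]_m) :=
  ((\1 - projv <[f (psi a)]>) \o f)%VF.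

Lemma contractE f a x : contract f a x = f x - projv <[f (psi a)]> (f x).
Proof. by rewrite comp_lfunE add_lfunE opp_lfunE id_lfunE. Qed.

Lemma span_dim_contract f a : (span_dim f <= (span_dim (contract f a)).+1)%N.
Proof.
rewrite /span_dim.
set U := <<[seq contract f a (psi i) | i : I]>>%VS.
have sub : (<<[seq f (psi i) | i : I]>> <= U + <[f (psi a)]>)%VS.
  apply/span_subvP => u /mapP[i _ ->].
  rewrite -[f (psi i)](subrK (projv <[f (psi a)]> (f (psi i)))) -contractE.
  by apply: memv_add; [apply/memv_span/image_f | exact: memv_proj].
apply: leq_trans (dimvS sub) _; apply: leq_trans (dimv_add_leqif _ _).1 _.
by rewrite dim_vline; case: (_ != 0); rewrite ?addn0 ?addn1.
Qed.

(** For a value [x], this says that contracting [f (psi a)] merges [x] with a different value. *)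
Definition moved f (x : 'cV['F_2]_m) (a : I) : bool :=
  (f (psi a) != 0) && (x + f (psi a) \in values f).

(** Give a value weight 1 if it is moved and 2 otherwise. The fibre over a contracted value contains
    an unmoved value or two moved partners, so it weighs at least 2. *)
Lemma card_values_contract f a :
  (2 * #|values (contract f a)| + #|[set x in values f | moved f x a]|
     <= 2 * #|values f|)%N.
Proof.
set v := f (psi a).
pose g x := x - projv <[v]> x.
have gv x : g (x + v) = g x.
  by rewrite /g linearD /= (projv_id (memv_line v)) opprD addrACA subrr addr0.
have H : (2 * #|values (contract f a)| <= \sum_(x in values f) (2 - moved f x a))%N.
  apply: (@leq_sum_fiber _ _ _ _ g) => _ /imsetP[i _ ->].
  have xX : f (psi i) \in values f by exact: imset_f.
  have gx : g (f (psi i)) == contract f a (psi i) by rewrite contractE.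
  rewrite (bigD1 (f (psi i))) /=; last by rewrite xX.
  case: (boolP (moved f (f (psi i)) a)) => [/andP[v0 xv]|_]; last by [].
  rewrite (bigD1 (f (psi i) + v)) /=; last first.
    by rewrite xv gv gx -subr_eq0 addrAC subrr add0r.
  by case: moved => /=; lia.
have E : (\sum_(x in values f) (2 - moved f x a) + #|[set x in values f | moved f x a]|
   = 2 * #|values f|)%N.
  rewrite -sum1dep_card big_mkcondr -big_split mulnC -sum_nat_const /=.
  by apply: eq_bigr => x _; case: moved.
lia.
Qed.

(** Write x = f (psi b). A zero pair (a, c) gives f (psi c) = x + f (psi a), so either [a] moves
    [x], or f (psi a) = 0 and [c] lies over [x]. One entry of the pair leaves at most [t] choices
    for the other. *)
Lemma pairs_le_moved f x : x \in values f ->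
  (2 * sigma <= t * #|[set a | moved f x a]| + t * #|[set c | f (psi c) == x]|)%N.
Proof.
case/imsetP => b _ ->; apply: leq_trans (pairs_ge b) _.
pose A1 := [set a | moved f (f (psi b)) a].
pose A2 := [set c | f (psi c) == f (psi b)].
pose B a := [set c | psi c == psi b + psi a].
pose Q (A : {set I}) := [set p : I * I | (p.1 \in A) && (p.2 \in B p.1)].
have hB a : (#|B a| <= t)%N by exact: fiber_le.
(* Pairs with f (psi a) = 0 are counted by their second entry, hence the swap. *)
pose sw (p : I * I) := (p.2, p.1).
have sub : zero_pairs b \subset Q A1 :|: [set sw p | p in Q A2].
  apply/subsetP => -[a c]; rewrite inE /= => /and4P[_ _ _].
  rewrite add_eq0_F2 => /eqP hc.
  have ha : psi a == psi b + psi c.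
    by rewrite -hc addrA addvv_F2 add0r.
  have fc : f (psi c) = f (psi b) + f (psi a) by rewrite -hc linearD.
  rewrite in_setU.
  have [fa|fa] := eqVneq (f (psi a)) 0.
    apply/orP; right; apply/imsetP; exists (c, a) => //.
    by rewrite !inE /= ha fc fa addr0 eqxx.
  have fX : f (psi c) \in values f by exact: imset_f.
  by rewrite !inE /= /moved fa -fc fX hc eqxx.
apply: leq_trans (subset_leq_card sub) _.
apply: leq_trans (leq_card_setU _ _) _.
apply: leq_add; first by apply: card_dep_pairs.
by apply: leq_trans (leq_imset_card _ _) _; apply: card_dep_pairs.
Qed.

Lemma sum_card_fibers f :
  (\sum_(x in values f) #|[set c | f (psi c) == x]| = #|I|)%N.
Proof.
rewrite -[RHS]sum1_card (partition_big (fun c => f (psi c)) (mem (values f))) /=.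
  by apply: eq_bigr => x _; rewrite sum1dep_card.
by move=> i _; exact: imset_f.
Qed.

(** Sum [pairs_le_moved] over all values and take an [a] that moves at least the average number of
    them. The fibre terms add up to [#|I|]; they cause the loss of 1/2 per step. *)
Lemma exists_contraction f (i0 : I) : exists a,
  (2 * t * #|I| * #|values (contract f a)| + 2 * sigma * #|values f|
     <= 2 * t * #|I| * #|values f| + t * #|I|)%N.
Proof.
pose M a := #|[set x in values f | moved f x a]|.
have [a ha] := exists_average M i0; exists a.
have hsum : (2 * sigma * #|values f| <= t * (\sum_b M b) + t * #|I|)%N.
  have -> : (\sum_b M b = \sum_(x in values f) #|[set b | moved f x b]|)%N.
    under eq_bigr => b _ do rewrite /M -sum1dep_card big_mkcondr.
    rewrite exchange_big /=; apply: eq_bigr => x _.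
    by rewrite -sum1dep_card [RHS]big_mkcond.
  rewrite -(sum_card_fibers f) -mulnDr -big_split big_distrr /= mulnC -sum_nat_const.
  by apply: leq_sum => x hx; rewrite mulnDr pairs_le_moved.
have hc := card_values_contract f a; rewrite -/(M a) in hc.
nia.
Qed.

(* The bound is affine in the number q of values; its slope 1 / (r - 1/2) pays
   for one contraction, and its constant term makes it equal to q at
   q = N / r, below which the dimension is simply bounded by q. *)
Lemma span_dim_bound (R : realFieldType) (N r : R) (f : 'End('cV['F_2]_m)) :
  (0 < t)%N -> 2 <= r -> #|I|%:R = t%:R * N -> sigma%:R = (t%:R * r) ^+ 2 ->
  (span_dim f)%:R <= N / r * (1 - (r - 2^-1)^-1) + #|values f|%:R / (r - 2^-1).
Proof.
move=> t_gt0 r_ge2 cardI sigmaE.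
have t0 : 0 < t%:R :> R by rewrite ltr0n.
have d_gt0 : 0 < r - 2^-1 by lra.
have d_inv1 : (r - 2^-1)^-1 <= 1 by rewrite invf_le1 //; lra.
have d_mul : (r - 2^-1) * (r - 2^-1)^-1 = 1 by rewrite divff // gt_eqF.
have d_inv0 : 0 < (r - 2^-1)^-1 by rewrite invr_gt0.
move: (r - 2^-1)^-1 d_inv1 d_mul d_inv0 => e d_inv1 d_mul d_inv0.
have N_ge0 : 0 <= N by rewrite -(pmulr_rge0 _ t0) -cardI.
have Nr : N = N / r * r by rewrite divfK // gt_eqF //; lra.
have [k] := ubnP #|values f|; elim: k f => // k IH f; rewrite ltnS => fk.
(* As 0 < e <= 1, the bound is a convex combination of N / r and q, hence at least q in the small
   case. *)
have [small|large] := lerP (#|values f|%:R) (N / r).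
  have := dim_span_image (fun i => f (psi i)).
  rewrite -/(span_dim f) -/(values f) -(ler_nat R).
  nra.
have q_gt0 : (0 < #|values f|)%N.
  rewrite -(ltr0n R); apply: le_lt_trans large.
  by rewrite divr_ge0 //; lra.
have [_ /imsetP[i0 _ _]] := card_gt0P q_gt0.
have I_gt0 : 0 < #|I|%:R :> R by rewrite ltr0n; apply/card_gt0P; exists i0.
have N_gt0 : 0 < N by rewrite cardI pmulr_rgt0 in I_gt0.
have [a] := exists_contraction f i0.
rewrite -(ler_nat R) !natrD !natrM cardI sigmaE => ha.
have dimf := span_dim_contract f a.
rewrite -(ler_nat R) -natr1 in dimf.
set q := (#|values f|%:R : R) in large ha *.
set q' := (#|values (contract f a)|%:R : R) in ha.
(* Divided by 2 t^2 N, [ha] reads q' <= q + 1/2 - r^2 q / N, and q > N / r makes the subtracted term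
   at least r. *)
have drop : q' <= q - (r - 2^-1).
  have ht : (2 * t%:R ^+ 2) * (N * q' + r ^+ 2 * q) <= (2 * t%:R ^+ 2) * (N * q + N / 2).
    by move: ha; congr (_ <= _); field.
  rewrite ler_pM2l in ht; last by rewrite mulr_gt0 // exprn_gt0.
  have hr : N * r <= r ^+ 2 * q.
    rewrite expr2 mulrC -mulrA ler_pM2l; last by lra.
    by rewrite {1}Nr mulrC ler_pM2l ?ltW //; lra.
  rewrite -(ler_pM2l N_gt0); lra.
have lt_q : (#|values (contract f a)| < #|values f|)%N.
  by rewrite -(ltr_nat R); apply: le_lt_trans drop _; rewrite -/q; lra.
have := IH (contract f a) (leq_trans lt_q fk).
rewrite -/q'; nra.
Qed.

End Contraction.

(** * From weight-3 dual vectors to triples of columns with sum zero *)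

Lemma F2_neq0 (x : 'F_2) : (x != 0) = (x == 1).
Proof. by case: x => [[|[|]]]. Qed.

Lemma supp_inj (n : nat) : injective (@supp n).
Proof.
move=> u v /setP huv; apply/rowP => i.
have := huv i; rewrite !inE.
by move: (u 0 i) (v 0 i) => [[|[|//]] ?] [[|[|//]] ?] //= _; exact: val_inj.
Qed.

(** Coordinate k of the sum is the pairing of [v] with row k of [G], which lies in [C]. *)
Lemma dual_sum_cols (m n : nat) (C : {vspace 'rV['F_2]_n}) (G : 'M['F_2]_(m, n))
    (v : 'rV['F_2]_n) :
  generating_matrix C G -> v \in dual_code C -> \sum_(i in supp v) col i G = 0.
Proof.
move=> hgen; rewrite inE => /forall_inP hv.
apply/colP => k; rewrite summxE mxE.
have rowC : row k G \in C by rewrite -hgen; apply/memv_span/image_f.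
rewrite -[RHS](eqP (hv _ rowC)) big_mkcond /=; apply: eq_bigr => i _.
rewrite !inE !mxE F2_neq0; case: eqP => [->|/eqP]; first by rewrite mul1r.
by rewrite -F2_neq0 negbK => /eqP ->; rewrite mul0r.
Qed.

(** A dual vector is determined by its support {b, a, c}, and this set arises from both (a, c) and
    (c, a). *)
Lemma zero_pairs_ge (m n : nat) (C : {vspace 'rV['F_2]_n}) (G : 'M['F_2]_(m, n))
    (sigma : nat) (b : 'I_n) :
  generating_matrix C G -> locally_testable3 C sigma ->
  (2 * sigma <= #|zero_pairs (fun i => col i G) b|)%N.
Proof.
move=> hgen htest.
set T := [set v in dual_code C | hweight v == 3 & b \in supp v].
have hT : (sigma <= #|T|)%N := htest b.
rewrite -(card_imset _ (@supp_inj n)) in hT.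
apply: (@leq_trans (2 * #|[set supp v | v in T]|)%N); first by rewrite leq_mul2l.
rewrite -[leqRHS]sum1_card.
apply: (@leq_sum_fiber _ _ _ _ (fun p : 'I_n * 'I_n => [set b; p.1; p.2])).
move=> _ /imsetP[v vT ->]; rewrite sum1dep_card.
move: vT; rewrite inE => /and3P[vC /eqP v3 bv].
have : #|supp v :\ b| = 2 by move: v3; rewrite /hweight (cardsD1 b) bv => -[].
move/eqP/cards2P => [a [c [ac sE]]].
have suppE : supp v = [set b; a; c].
  by rewrite -(setD1K bv) sE setUA.
have ab : a != b by have := set21 a c; rewrite -sE !inE => /andP[].
have cb : c != b by have := set22 a c; rewrite -sE !inE => /andP[].
have sum0 : col b G + col a G + col c G = 0.
  have := dual_sum_cols hgen vC; rewrite (big_setD1 b bv) sE /=.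
  by rewrite big_setU1 ?inE //= big_set1 addrA.
have sub : [set (a, c); (c, a)] \subset
    [set p | (p \in zero_pairs (fun i => col i G) b) && ([set b; p.1; p.2] == supp v)].
  apply/subsetP => p; rewrite inE => /orP[] /set1P ->; rewrite !inE /= suppE.
    by rewrite ab cb ac sum0 !eqxx.
  by rewrite ab cb eq_sym ac addrAC sum0 setUAC !eqxx.
apply: leq_trans (subset_leq_card sub).
by rewrite cards2 xpair_eqE negb_and ac.
Qed.

Theorem theorem1p5 (R : rcfType) (m n : nat) (C : {vspace 'rV['F_2]_n})
    (G : 'M['F_2]_(m, n)) (sigma : nat)
    (hgen : generating_matrix C G)
    (hreg : equal_col_mult G)
    (hsigma : (1 <= sigma)%N)
    (htest : locally_testable3 C sigma) :
  (\dim C)%:R <= 2 / Num.sqrt (sigma%:R : R) * n%:R.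
Proof.
pose psi i := col i G.
pose id_f : 'End('cV['F_2]_m) := \1%VF.
have dimC : (\dim C <= span_dim psi id_f)%N.
  rewrite -hgen; apply: leq_trans (dim_rows_le_cols G) _.
  rewrite /span_dim (_ : [seq id_f (psi i) | i : 'I_n] = [seq psi i | i : 'I_n]) //.
  by apply: eq_map => i; rewrite id_lfunE.
have dimX : (\dim C <= #|values psi id_f|)%N.
  exact: leq_trans dimC (dim_span_image _).
have s_gt0 : 0 < Num.sqrt (sigma%:R : R) by rewrite sqrtr_gt0 ltr0n.
have dim_le : (\dim C <= n)%N.
  by rewrite (leq_trans dimX) // (leq_trans (leq_imset_card _ _)) // card_ord.
(* The multiplicity [t] is read off at a column, so n = 0 is treated apart. *)
have [n0|n_gt0] := posnP n.
  move: dim_le; rewrite [leqRHS]n0 leqn0 => /eqP ->.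
  by rewrite mulr_ge0 ?divr_ge0 // ltW.
pose i0 := Ordinal n_gt0; set t := col_mult G i0.
have fiberE i : #|[set k | psi k == psi i]| = t by exact: hreg.
have t_gt0 : (0 < t)%N by apply/card_gt0P; exists i0; rewrite inE.
have fiber_le w : (#|[set k | psi k == w]| <= t)%N.
  have [i /eqP <-|none] := pickP (fun i => psi i == w); first by rewrite fiberE.
  by rewrite eq_card0 // => k; rewrite inE none.
have cardX : (#|values psi id_f| * t = n)%N.
  rewrite -[RHS]card_ord -(sum_card_fibers psi id_f) -sum_nat_const.
  apply: eq_bigr => _ /imsetP[i _ ->]; rewrite -(fiberE i).
  by apply: eq_card => k; rewrite !inE !id_lfunE.
have t0 : 0 < t%:R :> R by rewrite ltr0n.
(* This is sqrt s for s = sigma / t^2. *)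
set r : R := Num.sqrt sigma%:R / t%:R.
have sE : Num.sqrt (sigma%:R : R) = t%:R * r by rewrite mulrC divfK // gt_eqF.
have r_gt0 : 0 < r by rewrite divr_gt0.
set N : R := #|values psi id_f|%:R.
have nE : n%:R = t%:R * N by rewrite -natrM mulnC cardX.
have -> : 2 / Num.sqrt (sigma%:R : R) * n%:R = 2 * (N / r).
  by rewrite sE nE; field; rewrite !gt_eqF.
have [r2|r2] := lerP 2 r; last first.
  have dN : (\dim C)%:R <= N by rewrite ler_nat.
  apply: le_trans dN _; rewrite mulrA ler_pdivlMr // mulrC ler_wpM2r //; lra.
have sigmaE : sigma%:R = (t%:R * r) ^+ 2 by rewrite -sE sqr_sqrtr.
have bound : (span_dim psi id_f)%:R <= N / r * (1 - (r - 2^-1)^-1) + N / (r - 2^-1).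
  apply: (span_dim_bound fiber_le _ _ t_gt0 r2 _ sigmaE); last by rewrite card_ord.
  by move=> b; exact: zero_pairs_ge hgen htest.
apply: le_trans (le_trans _ bound) _; first by rewrite ler_nat.
have N0 : 0 <= N by [].
(* At q = N the bound falls short of 2 N / r by (N / r) / (2 r - 1). *)
rewrite -subr_ge0 (_ : _ - _ = N / r * (2^-1 / (r - 2^-1))); last first.
  by field; rewrite !gt_eqF //; lra.
by rewrite mulr_ge0 ?divr_ge0 // ?ltW //; lra.
Qed.
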